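(* Let $k \geq 1$ be a fixed integer. Then $Q(n,m,\mathcal{P}_{k2}) = \left( \frac{1}{4k} + O\!\left(\frac{1}{n}\right) + O\!\left(\frac{1}{m}\right) \right) n^2 m^2$ as $n,m\to\infty$, where $\mathcal{P}_{k2} = \{(2,k+1),(k+1,2)\}$. Moreover, if $k$ is even, then also $Q(n,m,\mathcal{P}_{k3}) = \left( \frac{1}{4k} + O\!\left(\frac{1}{n}\right) + O\!\left(\frac{1}{m}\right) \right) n^2 m^2$ as $n,m\to\infty$, where $\mathcal{P}_{k3} = \{(2,k+1),(3,k),(k,3),(k+1,2)\}$. (Here the implied constants in the $O$-terms depend only on $k$.)
   Context: Let $\mathcal{P}$ be a set of pairs $(a,b)$ of integers with $a,b \geq 2$. Let $A$ and $B$ be disjoint sets with $|A| = n$ and $|B| = m$. A quadruple here means a $4$-element subset of $A \cup B$ containing exactly $2$ elements of $A$ and exactly $2$ elements of $B$. Define $Q(n,m,\mathcal{P})$ to be the minimum size of a family $\mathcal{Q}$ of such quadruples with the property that for every $(a,b) \in \mathcal{P}$, every $(a+b)$-element subset $S \subseteq A \cup B$ with $|S \cap A| = a$ and $|S \cap B| = b$ contains at least one quadruple of $\mathcal{Q}$. (This value depends only on $n$, $m$, $\mathcal{P}$.) *)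

(* Defs.v *)
From mathcomp Require Import all_boot all_order all_algebra.
From mathcomp Require Import all_classical all_reals all_analysis.

Set Implicit Arguments.
Unset Strict Implicit.
Unset Printing Implicit Defensive.

Import Order.TTheory GRing.Theory Num.Theory.
Import numFieldNormedType.Exports.

(* The disjoint union of the two parts is the sum type A + B. *)
Definition profile (A B : finType) (S : {set A + B}) : nat * nat :=
  (#|inl @^-1: S|, #|inr @^-1: S|).

Definition quadruples (A B : finType) : {set {set A + B}} :=
  finset (fun S => profile S == (2, 2)).

Definition covering (A B : finType) (P : {pred nat * nat})
    (F : {set {set A + B}}) : bool :=
  (F \subset quadruples A B) &&
  [forall S : {set A + B}, (profile S \in P) ==> [exists T in F, T \subset S]].

(* If every (a, b) in P has a, b >= 2, then the default value quadruples is
   itself covering and this is a genuine minimum: see quadNP below. *)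
Definition quadN (n m : nat) (P : {pred nat * nat}) : nat :=
  #|[arg min_(F < quadruples 'I_n 'I_m | covering P F) #|F|]|.

Lemma covering_quadruples (A B : finType) (P : {pred nat * nat}) :
  {in P, forall ab, (1 < ab.1) && (1 < ab.2)} ->
  covering P (quadruples A B).
Proof.
move=> hP; rewrite /covering subxx; apply/forallP => S; apply/implyP => /hP.
rewrite /profile /= => /andP[/card_gt1P[a [a' [aS a'S aa']]]].
move=> /card_gt1P[b [b' [bS b'S bb']]]; rewrite !inE in aS a'S bS b'S.
pose T : {set A + B} := finset (mem [:: inl a; inl a'; inr b; inr b']).
apply/existsP; exists T; apply/andP; split; last first.
  by apply/fintype.subsetP => x; rewrite !inE => /or4P[] /eqP->.
rewrite inE /profile; apply/eqP; congr pair.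
  transitivity #|[set a; a']%SET|; last by rewrite cards2 aa'.
  by apply: eq_card => x; rewrite !inE /= orbF.
transitivity #|[set b; b']%SET|; last by rewrite cards2 bb'.
by apply: eq_card => x; rewrite !inE.
Qed.

Lemma quadNP (n m : nat) (P : {pred nat * nat}) :
  {in P, forall ab, (1 < ab.1) && (1 < ab.2)} ->
  (exists2 F : {set {set 'I_n + 'I_m}}, covering P F & #|F| = quadN n m P) /\
  (forall F : {set {set 'I_n + 'I_m}}, covering P F -> quadN n m P <= #|F|).
Proof.
move=> hP; rewrite /quadN; case: arg_minnP; first exact: covering_quadruples.
by move=> F cF minF; split=> //; exists F.
Qed.

Local Open Scope classical_set_scope.
Local Open Scope ring_scope.

Definition quadN_asymptotics (R : realType) (k : nat) (P : {pred nat * nat}) :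
    Prop :=
  exists e1 e2 : nat * nat -> R^o,
    [/\ e1 =O_ (filter_prod \oo \oo) (fun nm => nm.1%:R^-1 : R^o),
        e2 =O_ (filter_prod \oo \oo) (fun nm => nm.2%:R^-1 : R^o)
      & \forall nm \near (filter_prod \oo \oo),
          (quadN nm.1 nm.2 P)%:R =
          ((4 * k)%:R^-1 + e1 nm + e2 nm) * (nm.1%:R ^+ 2 * nm.2%:R ^+ 2)].

(* Main.v *)
(* Lower bound: for each pair a, a' of A the quadruples through a, a' form a
   graph on B meeting every (k+1)-set, so by Turan's theorem it has at least
   (m^2/k - m)/2 edges; now sum over the pairs.

   Upper bound: given M : A * B -> Z_k, take the quadruples {a,a',b,b'} with
   M a b - M a' b = M a b' - M a' b'. By pigeonhole, any two a, a' and any k+1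
   elements of B contain such a quadruple. For k even, so do any three a, a', a''
   and any k elements J of B: otherwise the three differences of rows of M would
   map J bijectively onto Z_k, so the sum of all elements of Z_k would be twice
   itself, whereas it is nonzero. Averaging over M, exactly 1/k of all
   quadruples are taken. *)
Require Import Defs.
From mathcomp Require Import all_boot all_order all_algebra.
From mathcomp Require Import zify ring lra.

Set Implicit Arguments.
Unset Strict Implicit.
Unset Printing Implicit Defensive.

Import GRing.Theory.

(** * Turan's theorem for reflexive symmetric relations *)

(* The diagonal pairs are counted, so that the sum is |S| plus twice the number
   of edges. Induction on k: delete the closed neighbourhood of a vertex of
   minimum degree. *)
Lemma turan_sym_refl (T : finType) (r : rel T) (k : nat) (S : {set T}) :
  reflexive r -> symmetric r ->
  (forall I : {set T}, I \subset S ->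
     {in I &, forall x y, x != y -> ~~ r x y} -> #|I| <= k) ->
  #|S| ^ 2 <= k * \sum_(x in S) #|[set y in S | r x y]|.
Proof.
move=> rr rs; elim: k S => [|k IHk] S indS.
  suff: #|S| <= 0 by rewrite leqn0 cards_eq0 => /eqP->; rewrite cards0.
  rewrite leqn0 cards_eq0 -subset0; apply/subsetP => x xS.
  have := indS [set x]; rewrite sub1set cards1 ltnn => /(_ xS) H.
  by exfalso; apply/notF/H => u v /set1P-> /set1P->; rewrite eqxx.
case: (set_0Vmem S) => [->|[x0 x0S]]; first by rewrite cards0.
pose N x := [set y in S | r x y].
have [v vS minv] : exists2 v, v \in S & forall x, x \in S -> #|N v| <= #|N x|.
  by case: (arg_minnP (fun x => #|N x|) x0S) => v; exists v.
pose U := S :\: N v.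
have US : U \subset S by apply: subsetDl.
have NS : N v \subset S by apply/subsetP => y; rewrite inE => /andP[].
(* An independent subset of [U] stays independent when [v] is added, so it has at most [k]
   elements. *)
have indU (I : {set T}) : I \subset U ->
    {in I &, forall x y, x != y -> ~~ r x y} -> #|I| <= k.
  move=> IU indI; have vI : v \notin I.
    by apply/negP => /(subsetP IU); rewrite !inE vS rr.
  have nrv x : x \in I -> ~~ r v x.
    by move=> /(subsetP IU); rewrite !inE => /andP[+ xS]; rewrite xS.
  have := indS (v |: I); rewrite cardsU1 vI ltnS; apply.
    by rewrite subUset sub1set vS (subset_trans IU).
  move=> x y /setU1P[->|xI] /setU1P[->|yI]; rewrite ?eqxx // => xy.
  - exact: nrv.
  - by rewrite rs nrv.
  - exact: indI.
have {IHk} := IHk U indU; set EU := \sum_(x in U) _ => IH.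
have cS : #|S| = #|N v| + #|U| by rewrite -(cardsID (N v) S) (setIidPr NS).
(* Each vertex of [N v] has at least [#|N v|] neighbours by minimality; for a vertex of [U] only the
   neighbours inside [U] are kept. *)
have ES : #|N v| ^ 2 + EU <= \sum_(x in S) #|N x|.
  rewrite (big_setID (N v)) /= (setIidPr NS); apply: leq_add.
    rewrite expnS expn1 -sum_nat_const; apply: leq_sum => x /(subsetP NS).
    exact: minv.
  apply: leq_sum => x _; apply: subset_leq_card; apply/subsetP => y.
  by rewrite !inE => /andP[/andP[_ ->]].
rewrite cS; apply: leq_trans (leq_mul (leqnn _) ES).
move: IH {ES}; move: #|N v| #|U| EU => d t e IH.
(* For [k = 0] the induction hypothesis forces [t = 0]. *)
case: k IH {indS indU} => [|k] IH; first by nia.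
(* Cauchy-Schwarz: [(d + t)^2 <= (k + 2) (d^2 + t^2 / (k + 1))] *)
rewrite -(leq_pmul2l (ltn0Sn k)).
have [sq _] := nat_Cauchy (k.+1 * d) t.
have IH2 : k.+2 * t ^ 2 <= k.+2 * (k.+1 * e) by rewrite leq_mul2l IH orbT.
nia.
Qed.

(** * Collisions of functions into Z_k *)

Section ZkFunctions.
Variables (k' : nat) (T : finType).
(** A successor, so that ['I_k] carries the additive group Z_k, the trivial group for [k = 1]
    included. *)
Let k := k'.+1.
Implicit Types (f : T -> 'I_k) (J : {set T}).
Local Open Scope ring_scope.

Definition collides f J := ~~ dinjectiveb f (mem J).

Lemma collidesP f J :
  reflect (exists x y, [/\ x \in J, y \in J, x != y & f x = f y]) (collides f J).
Proof.
apply: (iffP (dinjectivePn _ _)) => [[x xJ [y]]|[x [y [xJ yJ xy fxy]]]].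
  by rewrite !inE => /andP[yx yJ] fxy; exists x, y; rewrite eq_sym.
by exists x => //; exists y; rewrite // !inE eq_sym xy.
Qed.

Lemma collides_card f J : (k < #|J|)%N -> collides f J.
Proof.
move=> kJ; apply/negP => /dinjectiveP/card_in_imset cJ.
by have := max_card (mem (f @: J)); rewrite cJ card_ord leqNgt kJ.
Qed.

(** An injection from a set of size [k] into Z_k takes every residue exactly once. *)
Lemma sum_no_collision f J : #|J| = k -> ~~ collides f J ->
  \sum_(x in J) f x = \sum_(c : 'I_k) c.
Proof.
move=> cJ /negPn/dinjectiveP injf; rewrite -(big_imset id injf) /=.
apply: eq_bigl => c; suff -> : f @: J = [set: 'I_k] by rewrite inE.
by apply/eqP; rewrite eqEcard subsetT cardsT card_ord card_in_imset // cJ leqnn.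
Qed.

(** With [k = 2j] the sum is k(k-1)/2 = j(k-1), and 2j does not divide it because k-1 is odd. *)
Lemma sum_Zk_neq0 : ~~ odd k -> \sum_(c : 'I_k) c != 0.
Proof.
move=> evk; have -> : \sum_(c : 'I_k) c = inZp 'C(k, 2) :> 'I_k.
  rewrite -bin2_sum big_mkord (big_morph (@inZp k') (id1 := 0) (op1 := +%R)).
  - by apply: eq_bigr => c _; rewrite valZpK.
  - by move=> m n; apply: val_inj; rewrite /= modnDm.
  - by apply: val_inj; rewrite /= mod0n.
have /dvdnP[j kj] : (2 %| k)%N by rewrite dvdn2.
have j0 : (0 < j)%N by case: j kj.
have -> : 'C(k, 2) = (j * k')%N.
  by rewrite bin2 [k.-1]/= [in LHS]kj mulnAC muln2 doubleK.
rewrite -val_eqE /= -[_ == _]/(k %| _)%N kj dvdn_pmul2l // dvdn2.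
by move: evk; rewrite /k /= negbK => ->.
Qed.

(** Otherwise all three differences have the same sum s over [J], the sum of all residues. As u - w
    = (u - v) + (v - w), this gives s = s + s, so s = 0. *)
Lemma collides_three (u v w : T -> 'I_k) J : ~~ odd k -> #|J| = k ->
  [|| collides (u \- v) J, collides (v \- w) J | collides (u \- w) J].
Proof.
move=> evk cJ; apply: contraT; rewrite !negb_or => /and3P[uv vw uw].
have := sum_no_collision cJ uw; under eq_bigr => x _ do rewrite /= -(subrKA (v x)).
rewrite big_split /= (sum_no_collision cJ uv) (sum_no_collision cJ vw).
by move/eqP; rewrite -subr_eq0 addrK (negbTE (sum_Zk_neq0 evk)).
Qed.

End ZkFunctions.

(** * Quadruples and their labellings by ordered pairs *)

Section Quad.
Variables A B : finType.

Definition quad (a a' : A) (b b' : B) : {set A + B} :=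
  [set inl a; inl a'] :|: [set inr b; inr b'].

Lemma inl_quad a a' b b' x :
  (inl x \in quad a a' b b') = (x == a) || (x == a').
Proof. by rewrite !inE /= orbF. Qed.

Lemma inr_quad a a' b b' y :
  (inr y \in quad a a' b b') = (y == b) || (y == b').
Proof. by rewrite !inE. Qed.

Lemma preim_inl_quad a a' b b' : inl @^-1: quad a a' b b' = [set a; a'].
Proof. by apply/setP => x; rewrite inE inl_quad !inE. Qed.

Lemma preim_inr_quad a a' b b' : inr @^-1: quad a a' b b' = [set b; b'].
Proof. by apply/setP => x; rewrite inE inr_quad !inE. Qed.

Lemma quad_quadruples a a' b b' :
  (quad a a' b b' \in quadruples A B) = (a != a') && (b != b').
Proof.
rewrite inE /profile preim_inl_quad preim_inr_quad !cards2.
by case: (a != a'); case: (b != b').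
Qed.

Lemma quad_sub a a' b b' (S : {set A + B}) :
  (quad a a' b b' \subset S) =
  [&& inl a \in S, inl a' \in S, inr b \in S & inr b' \in S].
Proof. by rewrite /quad !subUset !sub1set -!andbA. Qed.

(** The right side is a condition on [a, a'] times a condition on [b, b'], so a sum over labellings
    of [T] factors into a sum over A and a sum over B. *)
Lemma quad_eq (T : {set A + B}) a a' b b' :
  T \in quadruples A B ->
  (quad a a' b b' == T) && ((a != a') && (b != b')) =
  (((a \in inl @^-1: T) && (a' \in inl @^-1: T)) && (a != a')) &&
  (((b \in inr @^-1: T) && (b' \in inr @^-1: T)) && (b != b')).
Proof.
rewrite inE => /eqP[cA cB]; apply/idP/idP.
  by case/andP => /eqP <- /andP[-> ->]; rewrite !inE !eqxx /= ?orbT.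
case/andP => /andP[/andP[aT a'T] aa'] /andP[/andP[bT b'T] bb'].
rewrite aa' bb' /= andbT; apply/eqP.
have -> : T = finset (fun u => match u with inl x => x \in inl @^-1: T
                                 | inr y => y \in inr @^-1: T end).
  by apply/setP => -[x|y]; rewrite !inE.
have eA : [set a; a'] = inl @^-1: T.
  by apply/eqP; rewrite eqEcard cA cards2 aa' subUset !sub1set aT a'T.
have eB : [set b; b'] = inr @^-1: T.
  by apply/eqP; rewrite eqEcard cB cards2 bb' subUset !sub1set bT b'T.
by rewrite -eA -eB; apply/setP => -[x|y]; rewrite !inE ?orbF.
Qed.

Lemma sum_distinct_pairs (T : finType) (C : {set T}) :
  \sum_(x : T) \sum_(y : T) (((x \in C) && (y \in C)) && (x != y))
  = #|C| * #|C|.-1.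
Proof.
rewrite (bigID (fun x => x \in C)) /= [X in _ + X]big1 ?addn0; last first.
  by move=> x /negbTE xC; rewrite big1 // => y _; rewrite xC.
rewrite -sum_nat_const; apply: eq_bigr => x xC.
rewrite (cardsD1 x) xC /= -sum1_card [RHS]big_mkcond /=.
by apply: eq_bigr => y _; rewrite !inE eq_sym andbC; case: ifP.
Qed.

(** Double counting: each quadruple has 2 orderings of its points in A and 2 of its points in B. *)
Lemma sum_mem_quad (F : {set {set A + B}}) : F \subset quadruples A B ->
  \sum_(a : A) \sum_(a' : A) \sum_(b : B) \sum_(b' : B)
     (quad a a' b b' \in F) = 4 * #|F|.
Proof.
move=> FQ.
transitivity (\sum_(T in F) \sum_(a : A) \sum_(a' : A) \sum_(b : B)
  \sum_(b' : B) (quad a a' b b' == T)).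
  under [RHS]eq_bigr => T _ do rewrite pair_bigA pair_bigA pair_bigA /=.
  rewrite [RHS]exchange_big /= pair_bigA pair_bigA pair_bigA /=.
  apply: eq_bigr => -[[[a a'] b] b'] _ /=; set q := quad _ _ _ _.
  have [qF|qF] := boolP (q \in F).
    by rewrite (bigD1 q) //= eqxx big1 // => T /andP[_ /negbTE]; rewrite eq_sym => ->.
  by rewrite big1 // => T TF; apply/eqP; rewrite eqb0; apply: contraNneq qF => ->.
rewrite mulnC -sum_nat_const; apply: eq_bigr => T /(subsetP FQ) TQ.
have := TQ; rewrite inE => /eqP[cA cB].
transitivity (\sum_(a : A) \sum_(a' : A)
   (((a \in inl @^-1: T) && (a' \in inl @^-1: T)) && (a != a')) *
   \sum_(b : B) \sum_(b' : B)
   (((b \in inr @^-1: T) && (b' \in inr @^-1: T)) && (b != b'))).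
  apply: eq_bigr => a _; apply: eq_bigr => a' _.
  rewrite big_distrr /=; apply: eq_bigr => b _.
  rewrite big_distrr /=; apply: eq_bigr => b' _.
  rewrite mulnb -quad_eq // -quad_quadruples.
  by case: eqP => [->|//]; rewrite TQ.
under eq_bigr => a _ do rewrite -big_distrl /=.
by rewrite -big_distrl /= !sum_distinct_pairs cA cB.
Qed.

(** * Lower bound *)

(** The Turan bound for a pair [a, a'] is summed over the ordered pairs, whence the factor 4. Terms
    are arranged so that no difference of naturals occurs apart from the predecessor. *)
Lemma covering_lower_bound (P : {pred nat * nat}) (k : nat)
    (F : {set {set A + B}}) :
  (2, k.+1) \in P -> covering P F ->
  #|A| * #|A|.-1 * #|B| ^ 2 <= k * (#|A| * #|A|.-1 * #|B| + 4 * #|F|).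
Proof.
move=> Pk /andP[FQ /forallP cF].
have pairbound a a' : a != a' ->
    #|B| ^ 2 <= k * (#|B| + \sum_(b : B) \sum_(b' : B) (quad a a' b b' \in F)).
  (* Loops make the relation reflexive; they contribute the term [#|B|]. *)
  move=> aa'; pose r b b' := (b == b') || (quad a a' b b' \in F).
  have rr : reflexive r by move=> b; rewrite /r eqxx.
  have quadC b b' : quad a a' b b' = quad a a' b' b by rewrite /quad (setUC [set inr b]).
  have rs : symmetric r by move=> b b'; rewrite /r eq_sym quadC.
  have := @turan_sym_refl _ r k [set: B] rr rs; rewrite cardsT.
  have -> : \sum_(x in [set: B]) #|[set y in [set: B] | r x y]| =
     #|B| + \sum_(b : B) \sum_(b' : B) (quad a a' b b' \in F).
    rewrite -sum1_card -big_split /=; apply: eq_big => [b|b _]; first by rewrite inE.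
    rewrite -sum1_card [LHS]big_mkcond /= (bigD1 b) //= !inE rr /=; congr (1 + _).
    rewrite [RHS](bigD1 b) //= [X in (X : nat) + _](_ : _ = 0); last first.
      apply/eqP; rewrite eqb0; apply: (contraNN (subsetP FQ _)).
      by rewrite quad_quadruples eqxx andbF.
    by apply: eq_bigr => b' bb'; rewrite !inE /r eq_sym (negbTE bb') /=; case: (_ \in F).
  apply=> I _ indI; rewrite leqNgt; apply/negP => kI.
  (* [covering] speaks of sets of an exact profile, so an independent set that is too large is first
     cut down to [k + 1] elements. *)
  have [J JI cJ] : exists2 J : {set B}, J \subset I & #|J| = k.+1.
    have := kI; rewrite -bin_gt0 -cards_draws card_gt0 => /set0Pn[J].
    by rewrite inE => /andP[JI /eqP cJ]; exists J.
  pose S : {set A + B} := [set inl a; inl a'] :|: inr @: J.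
  have inlS : inl @^-1: S = [set a; a'].
    apply/setP => x; rewrite !inE; case: imsetP => [[]//|_]; by rewrite orbF.
  have inrS : inr @^-1: S = J.
    by apply/setP => y; rewrite !inE mem_imset // => ? ? [].
  have := cF S; rewrite /profile inlS inrS cards2 aa' cJ Pk /= => /existsP[T].
  case/andP=> TF TS; have TQ := subsetP FQ _ TF.
  have := TQ; rewrite inE => /eqP[cA cB].
  (* A quadruple inside [S] has two points in A, necessarily [a] and [a'], so its other two points
     form an edge inside [J]. *)
  have Aeq : inl @^-1: T = [set a; a'].
    apply/eqP; rewrite eqEcard cA cards2 aa' andbT -inlS.
    exact: preimsetS.
  have BJ : inr @^-1: T \subset J by rewrite -inrS; apply: preimsetS.
  have /card_gt1P[b [b' [bT b'T bb']]] : 1 < #|inr @^-1: T| by rewrite cB.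
  have : quad a a' b b' \in F.
    suff /andP[/eqP-> //] : (quad a a' b b' == T) && ((a != a') && (b != b')).
    by rewrite quad_eq // Aeq bT b'T aa' bb' !inE !eqxx orbT.
  apply/negP; have := indI b b'.
  by rewrite !(subsetP JI _ (subsetP BJ _ _)) // /r (negbTE bb') /=; apply.
rewrite -(sum_mem_quad FQ) -cardsT -sum_distinct_pairs.
rewrite !big_distrl -big_split big_distrr /=; apply: leq_sum => a _.
rewrite !big_distrl -big_split big_distrr /=; apply: leq_sum => a' _.
by rewrite !inE /=; case: eqP => //= /eqP/pairbound; rewrite !mul1n.
Qed.


(** * Upper bound: quadruples selected by a matrix over Z_k *)

Section Collisions.
Variable k' : nat.
Let k := k'.+1.
Implicit Types (M : {ffun A * B -> 'I_k}) (S : {set A + B}).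
Local Open Scope ring_scope.

Definition defect M a a' b b' := M (a, b) - M (a', b) - (M (a, b') - M (a', b')).

(** Adding [c] to the single entry [(a, b)] permutes the matrices and shifts the defect by [c], so
    all [k] values of the defect are equally frequent. *)
Lemma card_defect_eq0 a a' b b' : a != a' -> b != b' ->
  (#|[set M | defect M a a' b b' == 0%R]| * k = #|{ffun A * B -> 'I_k}|)%N.
Proof.
move=> aa' bb'; pose E (c : 'I_k) := [ffun p : A * B => if p == (a, b) then c else 0].
have dE M c : defect (M + E c) a a' b b' = defect M a a' b b' + c.
  rewrite /defect !ffunE eqxx !xpair_eqE !(eq_sym _ a) !(eq_sym _ b) (negbTE aa').
  by rewrite (negbTE bb') eqxx andbF /= !addr0 [_ + c - _]addrAC [_ + c - _]addrAC.
have cE c : #|[set M | defect M a a' b b' == c]| = #|[set M | defect M a a' b b' == 0%R]|.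
  rewrite -(card_preimset _ (addIr (E c))); apply: eq_card => M.
  by rewrite !inE dE -subr_eq0 addrK.
rewrite -[RHS]sum1_card [RHS](partition_big (fun M => defect M a a' b b') predT) //=.
rewrite mulnC -[X in (X * _)%N]card_ord -sum_nat_const; apply: eq_big => // c _.
by rewrite -(cE c) -sum1_card; apply: eq_bigl => M; rewrite inE.
Qed.

(** A set has no preferred labelling, so all labellings are required to have defect 0;
    [quad_zero_defect] shows that one suffices. *)
Definition zero_defect M : {set {set A + B}} :=
  [set T in quadruples A B | [forall a, forall a', forall b, forall b',
     (quad a a' b b' \subset T) && (a != a') && (b != b') ==>
     (defect M a a' b b' == 0)]].

Lemma zero_defect_quadruples M : zero_defect M \subset quadruples A B.
Proof. by apply/subsetP => T; rewrite inE => /andP[]. Qed.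

Lemma quad_zero_defect M a a' b b' :
  (quad a a' b b' \in zero_defect M) = (a != a') && (b != b') && (defect M a a' b b' == 0).
Proof.
rewrite inE quad_quadruples; have [aa'|//] := boolP (a != a').
have [bb'|//] := boolP (b != b'); rewrite /=; apply/idP/idP.
  by move=> /'forall_'forall_'forall_'forall_implyP; apply; rewrite subxx aa' bb'.
move=> d0; apply/'forall_'forall_'forall_'forall_implyP => x x' y y'.
rewrite quad_sub !inl_quad !inr_quad -!andbA.
(* Exchanging the two points on either side only changes the sign of the defect. *)
have swapa u u' v v' : (defect M u u' v v' == 0) = (defect M u' u v v' == 0).
  by rewrite -oppr_eq0 /defect opprD opprB [- (M (u, v') - _)]opprB.
have swapb u u' v v' : (defect M u u' v v' == 0) = (defect M u u' v' v == 0).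
  by rewrite -oppr_eq0 /defect opprB.
case/and5P => /orP[]/eqP-> /orP[]/eqP-> /orP[]/eqP-> /orP[]/eqP->;
  rewrite ?eqxx ?andbF //= => _;
  by [exact: d0|rewrite swapa|rewrite swapb|rewrite swapa swapb].
Qed.


(** Each quadruple is selected by exactly one [k]-th of the matrices; exchange the sums over
    matrices and quadruples. *)
Lemma sum_card_zero_defect :
  (\sum_M k * #|zero_defect M| = #|{ffun A * B -> 'I_k}| * #|quadruples A B|)%N.
Proof.
(* The factor 4 turns both cardinals into sums over labellings. *)
apply/eqP; rewrite -(eqn_pmul2l (isT : 0 < 4)%N); apply/eqP.
rewrite mulnCA -(sum_mem_quad (subxx (quadruples A B))) !big_distrr /=.
transitivity (\sum_M \sum_(a : A) \sum_(a' : A) \sum_(b : B) \sum_(b' : B)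
   (k * (quad a a' b b' \in zero_defect M)))%N.
  apply: eq_bigr => M _; rewrite mulnCA -sum_mem_quad ?zero_defect_quadruples //.
  by do 4 (rewrite big_distrr /=; apply: eq_bigr => ? _).
do 4 (rewrite exchange_big /=; apply: eq_bigr => ? _; rewrite ?big_distrr /=).
rewrite -big_distrr /= quad_quadruples; set d := _ && _.
under eq_bigr => M _ do rewrite quad_zero_defect -/d -mulnb.
rewrite -big_distrr /=; case: (boolP d) => [/andP[aa' bb']|_]; last by rewrite mul0n !muln0.
rewrite mul1n muln1 -(card_defect_eq0 aa' bb') mulnC; congr (_ * _)%N.
by rewrite -sum1_card [RHS]big_mkcond /=; apply: eq_bigr => M _; rewrite inE.
Qed.

Lemma exists_small_zero_defect : exists M, (k * #|zero_defect M| <= #|quadruples A B|)%N.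
Proof.
apply/existsP; apply: contraT; rewrite negb_exists => /forallP big.
suff : (#|{ffun A * B -> 'I_k}| * #|quadruples A B| < \sum_M k * #|zero_defect M|)%N.
  by rewrite sum_card_zero_defect ltnn.
(* One matrix must exist for the termwise strict inequalities to give a strict inequality of
   sums. *)
have M0 : {ffun A * B -> 'I_k} := [ffun => ord0].
rewrite -sum_nat_const (bigD1 M0) // [ltnRHS](bigD1 M0) //= -addSn.
apply: leq_add; first by rewrite ltnNge big.
by apply: leq_sum => M _; rewrite ltnW // ltnNge big.
Qed.

Definition meets M (S : {set A + B}) := [exists T in zero_defect M, T \subset S].

Lemma meets_quad M S a a' b b' : a \in inl @^-1: S -> a' \in inl @^-1: S ->
  b \in inr @^-1: S -> b' \in inr @^-1: S ->
  a != a' -> b != b' -> defect M a a' b b' = 0 -> meets M S.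
Proof.
rewrite !inE => aS a'S bS b'S aa' bb' d0; apply/existsP; exists (quad a a' b b').
by rewrite quad_zero_defect aa' bb' d0 eqxx quad_sub aS a'S bS b'S.
Qed.

Definition coldiff M a a' b := M (a, b) - M (a', b).
Definition rowdiff M b b' a := M (a, b) - M (a, b').

Lemma meets_coldiff M S a a' : a \in inl @^-1: S -> a' \in inl @^-1: S ->
  a != a' -> collides (coldiff M a a') (inr @^-1: S) -> meets M S.
Proof.
move=> aS a'S aa' /collidesP[b [b' [bS b'S bb' /eqP]]]; rewrite -subr_eq0 => /eqP.
exact: meets_quad.
Qed.

(** The defect is unchanged when the roles of A and B are exchanged: regrouping its four terms turns
    it into a difference of two values of [rowdiff]. *)
Lemma meets_rowdiff M S b b' : b \in inr @^-1: S -> b' \in inr @^-1: S ->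
  b != b' -> collides (rowdiff M b b') (inl @^-1: S) -> meets M S.
Proof.
move=> bS b'S bb' /collidesP[a [a' [aS a'S aa' /eqP]]].
rewrite -subr_eq0 => /eqP d0; apply: (meets_quad aS a'S bS b'S) => //.
by rewrite -d0 /defect /rowdiff !opprD addrACA.
Qed.

Lemma meets_2k M S : (1 < #|inl @^-1: S|)%N -> (k < #|inr @^-1: S|)%N -> meets M S.
Proof.
case/card_gt1P => a [a' [aS a'S aa']] kS.
by apply: (meets_coldiff aS a'S aa'); apply: collides_card.
Qed.

Lemma meets_k2 M S : (k < #|inl @^-1: S|)%N -> (1 < #|inr @^-1: S|)%N -> meets M S.
Proof.
move=> kS /card_gt1P[b [b' [bS b'S bb']]].
by apply: (meets_rowdiff bS b'S bb'); apply: collides_card.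
Qed.

Lemma meets_3k M S : ~~ odd k -> (2 < #|inl @^-1: S|)%N -> #|inr @^-1: S| = k ->
  meets M S.
Proof.
move=> evk /card_gt2P[a [b [c [[aS bS cS] [ab bc ca]]]]] kS.
have /or3P[] := collides_three (fun y => M (a, y)) (fun y => M (b, y))
  (fun y => M (c, y)) evk kS.
- exact: meets_coldiff.
- exact: meets_coldiff.
- by apply: meets_coldiff; rewrite // eq_sym.
Qed.

Lemma meets_k3 M S : ~~ odd k -> #|inl @^-1: S| = k -> (2 < #|inr @^-1: S|)%N ->
  meets M S.
Proof.
move=> evk kS /card_gt2P[a [b [c [[aS bS cS] [ab bc ca]]]]].
have /or3P[] := collides_three (fun x => M (x, a)) (fun x => M (x, b))
  (fun x => M (x, c)) evk kS.
- exact: meets_rowdiff.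
- exact: meets_rowdiff.
- by apply: meets_rowdiff; rewrite // eq_sym.
Qed.

Lemma covering_zero_defect_pred2 M : covering (pred2 (2, k.+1) (k.+1, 2)) (zero_defect M).
Proof.
rewrite /covering zero_defect_quadruples; apply/forallP => S; apply/implyP.
rewrite !inE -/(meets M S) => /orP[]/eqP[cA cB]; [apply: meets_2k|apply: meets_k2];
  by rewrite ?cA ?cB.
Qed.

Lemma covering_zero_defect_pred4 M : ~~ odd k ->
  covering (pred4 (2, k.+1) (3, k) (k, 3) (k.+1, 2)) (zero_defect M).
Proof.
move=> evk; rewrite /covering zero_defect_quadruples; apply/forallP => S; apply/implyP.
rewrite !inE -/(meets M S) => /or4P[]/eqP[cA cB];
  [apply: meets_2k|apply: meets_3k|apply: meets_k3|apply: meets_k2];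
  by rewrite ?cA ?cB.
Qed.

End Collisions.

(** * Integer bounds for the minimum *)

Lemma card_quadruples :
  4 * #|quadruples A B| = #|A| * #|A|.-1 * (#|B| * #|B|.-1).
Proof.
rewrite -sum_mem_quad // -(cardsT A) -(cardsT B) -!sum_distinct_pairs.
rewrite big_distrl; apply: eq_bigr => a _ /=; rewrite big_distrl; apply: eq_bigr => a' _ /=.
rewrite big_distrr; apply: eq_bigr => b _ /=; rewrite big_distrr; apply: eq_bigr => b' _ /=.
by rewrite quad_quadruples !inE mulnb.
Qed.

End Quad.

(** Every matrix is required to give a covering, because averaging does not tell which one gives a
    small family. *)
Lemma quadN_bounds (n m k' : nat) (P : {pred nat * nat}) :
  {in P, forall ab, (1 < ab.1) && (1 < ab.2)} -> (2, k'.+2) \in P ->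
  (forall M : {ffun 'I_n * 'I_m -> 'I_k'.+1}, covering P (zero_defect M)) ->
  4 * (k'.+1 * quadN n m P) <= n * n.-1 * (m * m.-1) /\
  n * n.-1 * m ^ 2 <= k'.+1 * (n * n.-1 * m + 4 * quadN n m P).
Proof.
move=> hP Pk covM; have [[F covF <-] minF] := quadNP n m hP; split.
  have [M smallM] := exists_small_zero_defect 'I_n 'I_m k'.
  have := card_quadruples 'I_n 'I_m; rewrite !card_ord => <-.
  rewrite leq_pmul2l //; apply: leq_trans smallM; rewrite leq_mul2l /=.
  by rewrite minF.
by have := covering_lower_bound Pk covF; rewrite !card_ord.
Qed.

(* Asymptotics *)
(* Imported only here: these libraries redefine the finite set notations. *)
From mathcomp Require Import all_classical all_reals all_analysis.
Import Order.TTheory Num.Theory numFieldNormedType.Exports.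
Local Open Scope classical_set_scope.
Local Open Scope ring_scope.

(** Over the denominator 4k n^2 m^2, the numerator 4kq - n^2 m^2 is at most 0 by the first bound and
    at least -k nm(n+m) by the second. *)
Lemma density_error (R : realType) (n m k q : nat) :
  (0 < n)%N -> (0 < m)%N -> (0 < k)%N ->
  (4 * (k * q) <= n * n.-1 * (m * m.-1))%N ->
  (n * n.-1 * m ^ 2 <= k * (n * n.-1 * m + 4 * q))%N ->
  `|q%:R / (n%:R ^+ 2 * m%:R ^+ 2) - (4 * k)%:R^-1| <= n%:R^-1 + m%:R^-1 :> R.
Proof.
case: n m => [//|n] [//|m] _ _ k0; rewrite /= -!(ler_nat R).
rewrite !(natrM, natrD, natrX).
have : 1 <= k%:R :> R by rewrite ler1n.
have : m.+1%:R = m%:R + 1 :> R by rewrite natr1.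
have : n.+1%:R = n%:R + 1 :> R by rewrite natr1.
have : 0 <= m%:R :> R by [].
have : 0 <= n%:R :> R by [].
move: (n%:R : R) (m%:R : R) (n.+1%:R : R) (m.+1%:R : R) (k%:R : R) (q%:R : R).
move=> x' y' x y K Q x'0 y'0 Ex Ey K1 up lo.
have x0 : 0 < x by lra.
have y0 : 0 < y by lra.
have -> : Q / (x ^+ 2 * y ^+ 2) - (4 * K)^-1 =
   (4 * K * Q - x ^+ 2 * y ^+ 2) / (4 * K * (x ^+ 2 * y ^+ 2)).
  by field; rewrite ?gt_eqF //; lra.
have d0 : 0 < 4 * K * (x ^+ 2 * y ^+ 2).
  by rewrite !mulr_gt0 ?exprn_gt0 //; lra.
have -> : x^-1 + y^-1 = (4 * K * (x * y * (x + y))) / (4 * K * (x ^+ 2 * y ^+ 2)).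
  by field; rewrite ?gt_eqF //; lra.
rewrite normrM [`|_^-1|]gtr0_norm ?invr_gt0 // ler_pM2r ?invr_gt0 //.
(* These monomial bounds make the remaining inequalities linear in the monomials. *)
have xxy : 0 <= x * x * y by rewrite !mulr_ge0 ?ltW.
have xyy : 0 <= x * y * y by rewrite !mulr_ge0 ?ltW.
have Kxxy : x * x * y <= K * (x * x * y) by rewrite ler_peMl.
have Kxyy : x * y * y <= K * (x * y * y) by rewrite ler_peMl.
have Kxy : 0 <= K * (x * y) by rewrite !mulr_ge0 //; lra.
have x1 : 1 <= x by lra.
have xy : x * y <= x * x * y by rewrite -mulrA ler_peMl // mulr_ge0 // ltW.
have [Ex' Ey'] : x' = x - 1 /\ y' = y - 1 by split; lra.
rewrite Ex' Ey' in up lo; rewrite ler_norml; apply/andP; split; lra.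
Qed.

(** Since 1/x + 1/y = (x + y)/(xy), multiplying it by y/(x + y) leaves exactly 1/x. *)
Lemma share_le (R : realFieldType) (x y d : R) : 0 < x -> 0 < y ->
  `|d| <= x^-1 + y^-1 -> `|d * (y / (x + y))| <= x^-1.
Proof.
move=> x0 y0 dxy; have yxy : 0 < y / (x + y) by rewrite divr_gt0 ?addr_gt0.
rewrite normrM (gtr0_norm yxy); apply: le_trans (ler_wpM2r (ltW yxy) dxy) _.
by rewrite le_eqVlt; apply/orP; left; apply/eqP; field; rewrite ?gt_eqF ?addr_gt0.
Qed.

(** Criterion serving both families of the theorem: the pair [(2, k'.+2)] yields the lower bound,
    the selected quadruples the upper one. *)
Lemma quadN_asymptotics_zero_defect (R : realType) (k' : nat) (P : {pred nat * nat}) :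
  {in P, forall ab, (1 < ab.1)%N && (1 < ab.2)%N} -> (2, k'.+2) \in P ->
  (forall n m (M : {ffun 'I_n * 'I_m -> 'I_k'.+1}), covering P (zero_defect M)) ->
  quadN_asymptotics R k'.+1 P.
Proof.
move=> hP Pk covM.
(* The total error D = O(1/n + 1/m) is split as D m/(n+m) + D n/(n+m). *)
pose D (nm : nat * nat) : R :=
  (quadN nm.1 nm.2 P)%:R / (nm.1%:R ^+ 2 * nm.2%:R ^+ 2) - (4 * k'.+1)%:R^-1.
have pos : \forall nm \near filter_prod \oo \oo, (0 < nm.1)%N /\ (0 < nm.2)%N.
  exists ([set n | 0 < n]%N, [set m | 0 < m]%N); last by move=> [n m] [].
  by split; exact: nbhs_infty_gt.
have Dle (nm : nat * nat) : (0 < nm.1)%N -> (0 < nm.2)%N ->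
    `|D nm| <= nm.1%:R^-1 + nm.2%:R^-1.
  move=> n0 m0; have [up lo] := quadN_bounds hP Pk (@covM nm.1 nm.2).
  exact: density_error.
exists (fun nm => D nm * (nm.2%:R / (nm.1%:R + nm.2%:R))),
       (fun nm => D nm * (nm.1%:R / (nm.1%:R + nm.2%:R))); split.
- apply/eqO_exP; exists 1 => //; apply: filterS pos => nm [n0 m0] /=.
  rewrite mul1r [leRHS]gtr0_norm ?invr_gt0 ?ltr0n //.
  by apply: share_le; rewrite ?ltr0n ?Dle.
- apply/eqO_exP; exists 1 => //; apply: filterS pos => nm [n0 m0] /=.
  rewrite mul1r [leRHS]gtr0_norm ?invr_gt0 ?ltr0n // addrC.
  by apply: share_le; rewrite ?ltr0n // addrC Dle.
- apply: filterS pos => nm [n0 m0].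
  have x0 : nm.1%:R != 0 :> R by rewrite pnatr_eq0 -lt0n.
  have y0 : nm.2%:R != 0 :> R by rewrite pnatr_eq0 -lt0n.
  have s0 : nm.1%:R + nm.2%:R != 0 :> R by rewrite -natrD pnatr_eq0 -lt0n addn_gt0 n0.
  (* The two weights m/(n+m) and n/(n+m) add up to 1. *)
  rewrite -addrA -mulrDr -mulrDl [nm.2%:R + _]addrC divff // mulr1 /D addrC subrK.
  by rewrite divfK // mulf_neq0 // expf_neq0.
Qed.

Theorem theorem1 (R : realType) (k : nat) (hk : (1 <= k)%N) :
  quadN_asymptotics R k (pred2 (2, k.+1) (k.+1, 2)) /\
  (~~ odd k ->
   quadN_asymptotics R k (pred4 (2, k.+1) (3, k) (k, 3) (k.+1, 2))).
Proof.
case: k hk => [//|k' _]; split=> [|evk]; apply: quadN_asymptotics_zero_defect.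
- by move=> ab; rewrite !inE => /orP[]/eqP->.
- by rewrite !inE eqxx.
- by move=> n m M; apply: covering_zero_defect_pred2.
(* An even [k] is at least 2, so the pairs [(3, k)] and [(k, 3)] have both entries at least 2. *)
- by case: k' evk => // k' _ ab; rewrite !inE => /or4P[]/eqP->.
- by rewrite !inE eqxx.
- by move=> n m M; apply: covering_zero_defect_pred4.
Qed.
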